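(* Let $H=\mathcal{P}(G,R,D)$ be the pointed Hopf algebra defined in the context, and let the convolution invertible map $u:H\to A$ define an inner action of $H$ on a matrix algebra $A$ over $\mathbb{F}$. Then for any $1\le i<j\le n$ there exists $\zeta_{ij}\in\mathbb{F}$ such that $$u(x_j)u(x_i)-\chi_i(a_j)\,u(x_i)u(x_j)=\lambda_{ij}\,1_A+\zeta_{ij}\,u(a_i)u(a_j).$$
   Context: Let $\mathbb{F}$ be a field, $G$ a finite nontrivial abelian group, $\widehat{G}=\mathrm{Hom}(G,\mathbb{F}^\times)$ with $|\widehat{G}|=|G|$, and $\varepsilon$ the trivial character. Let $a_1,\dots,a_n\in G$, $\chi_1,\dots,\chi_n\in\widehat{G}$ satisfy $q_i:=\chi_i(a_i)\neq1$ for all $i$ and $\chi_j(a_i)\chi_i(a_j)=1$ for $i\ne j$ (the datum of a quantum linear space $R$ of rank $n$). Let $N_i$ be the order of $q_i$ in $\mathbb{F}^\times$. A compatible datum $D$ consists of $\mu_i\in\{0,1\}$ and $\lambda_{ij}\in\mathbb{F}$ ($1\le i<j\le n$) such that $\mu_i=0$ if $a_i^{N_i}=1$ or $\chi_i^{N_i}\ne\varepsilon$, and $\lambda_{ij}=0$ if $a_ia_j=1$ or $\chi_i\chi_j\neq\varepsilon$. The Hopf algebra $\mathcal{P}(G,R,D)$ is generated by $G$ and $x_1,\dots,x_n$ subject to the relations of $G$ and: $gx_i=\chi_i(g)x_ig$ for $g\in G$; $x_i^{N_i}=\mu_i(1-a_i^{N_i})$; $x_jx_i=\chi_i(a_j)x_ix_j+\lambda_{ij}(1-a_ia_j)$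 for $i<j$; with $\Delta(g)=g\otimes g$ for $g\in G$ and $\Delta(x_i)=x_i\otimes1+a_i\otimes x_i$. An action of $H$ on $A$ is an $H$-module algebra structure $(h,a)\mapsto h*a$. It is inner, via a convolution invertible linear map $u:H\to A$ normalized by $u(1)=1_A$, if $h*a=\sum u(h_{(1)})\,a\,u^{-1}(h_{(2)})$, with $u^{-1}$ the convolution inverse; thus $g*a=u(g)au(g)^{-1}$ and $x_i*a=u(x_i)a-u(a_i)au(a_i)^{-1}u(x_i)$. *)

(* Defs.v *)
(* boolp is used only to form quotients by Prop-valued congruences. *)
From HB Require Import structures.
From mathcomp Require Import all_boot all_order all_algebra all_fingroup cyclic ring.
(* fingroup has its own [repr] *)
From mathcomp Require Import generic_quotient.
From mathcomp Require Import boolp.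

Set Implicit Arguments.
Unset Strict Implicit.
Unset Printing Implicit Defensive.

Import GRing.Theory.
Local Open Scope ring_scope.
Local Open Scope quotient_scope.

Definition bilinear_map (F : fieldType) (U V W : lmodType F)
    (beta : U -> V -> W) : Prop :=
  (forall v, linear (beta^~ v)) /\ (forall u, linear (beta u)).

Section Tensor.
Variables (F : fieldType) (U V : lmodType F).

Definition sum_on (W : lmodType F) (beta : U -> V -> W) (s : seq (U * V)) : W :=
  \sum_(p <- s) beta p.1 p.2.

(* An element of [U (x) V] is represented by a finite formal sum of pairs, and
   two formal sums represent the same element when no bilinear map tells them
   apart. *)
Definition tensor_eq (s t : seq (U * V)) : Prop :=
  forall (W : lmodType F) (beta : U -> V -> W),
    bilinear_map beta -> sum_on beta s = sum_on beta t.

Definition tensor_rel (s t : seq (U * V)) : bool := `[< tensor_eq s t >].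

Lemma tensor_rel_refl : reflexive tensor_rel.
Proof. by move=> s; apply/asboolP. Qed.

Lemma tensor_rel_sym : symmetric tensor_rel.
Proof. by move=> s t; apply/asboolP/asboolP => st W b /st. Qed.

Lemma tensor_rel_trans : transitive tensor_rel.
Proof.
by move=> t s r /asboolP st /asboolP tr; apply/asboolP => W b hb; rewrite st ?tr.
Qed.

Canonical tensor_equiv :=
  EquivRel tensor_rel tensor_rel_refl tensor_rel_sym tensor_rel_trans.

Definition tensor : Type := {eq_quot tensor_equiv}.

HB.instance Definition _ := Choice.on tensor.
HB.instance Definition _ := EqQuotient.on tensor.

Definition pure (u : U) (v : V) : tensor := \pi_tensor [:: (u, v)].

(* The linear map induced on the tensor product by a bilinear map; it is
   independent of the representative only for bilinear [beta]. *)
Definition tensor_lift (W : lmodType F) (beta : U -> V -> W) (t : tensor) : W :=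
  sum_on beta (repr t).

Lemma tensor_lift_pi (W : lmodType F) (beta : U -> V -> W) s :
  bilinear_map beta -> tensor_lift beta (\pi_tensor s) = sum_on beta s.
Proof.
move=> hb; rewrite /tensor_lift.
have /eqmodP /asboolP := reprK (\pi_tensor s); exact.
Qed.

Lemma tensor_ext (t t' : tensor) :
  (forall (W : lmodType F) (beta : U -> V -> W),
     bilinear_map beta -> tensor_lift beta t = tensor_lift beta t') -> t = t'.
Proof.
by move=> h; rewrite -[t]reprK -[t']reprK; apply/eqmodP/asboolP => W b /h.
Qed.

Lemma eq_tensor_lift (W : lmodType F) (beta beta' : U -> V -> W) t :
  (forall u v, beta u v = beta' u v) -> tensor_lift beta t = tensor_lift beta' t.
Proof. by move=> h; apply: eq_bigr. Qed.

Definition tensor_zero : tensor := \pi_tensor [::].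
Definition tensor_add (t t' : tensor) : tensor := \pi_tensor (repr t ++ repr t').
Definition tensor_scale (c : F) (t : tensor) : tensor :=
  \pi_tensor [seq (c *: p.1, p.2) | p <- repr t].
Definition tensor_opp (t : tensor) : tensor := tensor_scale (- 1) t.

Section Lift.
Variables (W : lmodType F) (beta : U -> V -> W).
Hypothesis hb : bilinear_map beta.

Lemma bilinDl u u' v : beta (u + u') v = beta u v + beta u' v.
Proof. by have := hb.1 v 1 u u'; rewrite !scale1r. Qed.
Lemma bilinDr u v v' : beta u (v + v') = beta u v + beta u v'.
Proof. by have := hb.2 u 1 v v'; rewrite !scale1r. Qed.
Lemma bilin0l v : beta 0 v = 0.
Proof. by apply: (addrI (beta 0 v)); rewrite -bilinDl !addr0. Qed.
Lemma bilin0r u : beta u 0 = 0.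
Proof. by apply: (addrI (beta u 0)); rewrite -bilinDr !addr0. Qed.
Lemma bilinZl c u v : beta (c *: u) v = c *: beta u v.
Proof. by have := hb.1 v c u 0; rewrite !addr0 bilin0l addr0. Qed.
Lemma bilinZr c u v : beta u (c *: v) = c *: beta u v.
Proof. by have := hb.2 u c v 0; rewrite !addr0 bilin0r addr0. Qed.

Lemma tensor_lift0 : tensor_lift beta tensor_zero = 0.
Proof. by rewrite tensor_lift_pi // /sum_on big_nil. Qed.
Lemma tensor_liftD t t' :
  tensor_lift beta (tensor_add t t') = tensor_lift beta t + tensor_lift beta t'.
Proof. by rewrite tensor_lift_pi // /sum_on big_cat. Qed.
Lemma tensor_liftZ c t :
  tensor_lift beta (tensor_scale c t) = c *: tensor_lift beta t.
Proof.
rewrite tensor_lift_pi // /sum_on big_map scaler_sumr.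
by apply: eq_bigr => p _; rewrite bilinZl.
Qed.
Lemma tensor_lift_pure u v : tensor_lift beta (pure u v) = beta u v.
Proof. by rewrite tensor_lift_pi // /sum_on big_seq1. Qed.
End Lift.

Fact tensor_addA : associative tensor_add.
Proof. by move=> a b c; apply: tensor_ext => W f hf; rewrite !tensor_liftD // addrA. Qed.
Fact tensor_addC : commutative tensor_add.
Proof. by move=> a b; apply: tensor_ext => W f hf; rewrite !tensor_liftD // addrC. Qed.
Fact tensor_add0 : left_id tensor_zero tensor_add.
Proof.
by move=> a; apply: tensor_ext => W f hf; rewrite tensor_liftD // tensor_lift0 // add0r.
Qed.
Fact tensor_addN : left_inverse tensor_zero tensor_opp tensor_add.
Proof.
move=> a; apply: tensor_ext => W f hf.
by rewrite tensor_liftD // tensor_liftZ // tensor_lift0 // scaleN1r addNr.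
Qed.

HB.instance Definition _ := GRing.isZmodule.Build tensor
  tensor_addA tensor_addC tensor_add0 tensor_addN.

Fact tensor_scaleA a b t : tensor_scale a (tensor_scale b t) = tensor_scale (a * b) t.
Proof. by apply: tensor_ext => W f hf; rewrite !tensor_liftZ // scalerA. Qed.
Fact tensor_scale1 : left_id 1 tensor_scale.
Proof. by move=> t; apply: tensor_ext => W f hf; rewrite tensor_liftZ // scale1r. Qed.
Fact tensor_scaleDr : right_distributive tensor_scale +%R.
Proof.
move=> c s t; apply: tensor_ext => W f hf.
by rewrite tensor_liftZ // !tensor_liftD // !tensor_liftZ // scalerDr.
Qed.
Fact tensor_scaleDl t : {morph tensor_scale^~ t : a b / a + b}.
Proof.
move=> a b; apply: tensor_ext => W f hf.
by rewrite tensor_liftZ // tensor_liftD // !tensor_liftZ // scalerDl.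
Qed.

HB.instance Definition _ := GRing.Zmodule_isLmodule.Build F tensor
  tensor_scaleA tensor_scale1 tensor_scaleDr tensor_scaleDl.

Lemma tensor_lift_linear (W : lmodType F) (beta : U -> V -> W) :
  bilinear_map beta -> linear (tensor_lift beta).
Proof.
move=> hb c s t.
exact: etrans (tensor_liftD hb _ _) (congr1 (+%R^~ _) (tensor_liftZ hb _ _)).
Qed.

Lemma pure_bilinear : bilinear_map pure.
Proof.
by split=> [v|u] c x y; apply: tensor_ext => W f hf;
   rewrite (tensor_lift_linear hf) !tensor_lift_pure //
           ?bilinDl ?bilinDr ?bilinZl ?bilinZr.
Qed.

End Tensor.

Section TensorRing.
Variables (F : fieldType) (A B : algType F).
Local Notation T := (tensor A B).

Definition tensor_one : T := pure 1 1.
Definition tensor_mul (s t : T) : T :=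
  \pi_T [seq (p.1 * q.1, p.2 * q.2) | p <- repr s, q <- repr t].

Section Lift.
Variables (W : lmodType F) (beta : A -> B -> W).
Hypothesis hb : bilinear_map beta.

Lemma bilin_mulr c d : bilinear_map (fun a b => beta (a * c) (b * d)).
Proof.
by split=> [b|a] k x y; rewrite mulrDl -scalerAl;
   rewrite ?(bilinDl hb) ?(bilinDr hb) ?(bilinZl hb) ?(bilinZr hb).
Qed.
Lemma bilin_mull a b : bilinear_map (fun c d => beta (a * c) (b * d)).
Proof.
by split=> [d|c] k x y; rewrite mulrDr -scalerAr;
   rewrite ?(bilinDl hb) ?(bilinDr hb) ?(bilinZl hb) ?(bilinZr hb).
Qed.
Lemma bilin_mulr_lift (t : T) :
  bilinear_map (fun a b => tensor_lift (fun c d => beta (a * c) (b * d)) t).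
Proof.
by split=> [b|a] k x y; rewrite /tensor_lift /sum_on scaler_sumr -big_split;
   apply: eq_bigr => p _; rewrite mulrDl -scalerAl /=;
   rewrite ?(bilinDl hb) ?(bilinDr hb) ?(bilinZl hb) ?(bilinZr hb).
Qed.
Lemma tensor_liftM s t :
  tensor_lift beta (tensor_mul s t) =
  tensor_lift (fun a b => tensor_lift (fun c d => beta (a * c) (b * d)) t) s.
Proof. by rewrite tensor_lift_pi // /sum_on big_allpairs_dep. Qed.
End Lift.

Fact tensor_mulA : associative tensor_mul.
Proof.
move=> s t r; apply: tensor_ext => W f hf.
rewrite !tensor_liftM //; last exact: bilin_mulr_lift.
apply: eq_tensor_lift => a b; rewrite tensor_liftM; last exact: bilin_mull.
by do 2![apply: eq_tensor_lift => ? ?]; rewrite !mulrA.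
Qed.
Fact tensor_mul1 : left_id tensor_one tensor_mul.
Proof.
move=> t; apply: tensor_ext => W f hf.
rewrite tensor_liftM // tensor_lift_pure; last exact: bilin_mulr_lift.
by apply: eq_tensor_lift => a b; rewrite !mul1r.
Qed.
Fact tensor_mulr1 : right_id tensor_one tensor_mul.
Proof.
move=> t; apply: tensor_ext => W f hf; rewrite tensor_liftM //.
apply: eq_tensor_lift => a b.
by rewrite tensor_lift_pure ?mulr1 //; apply: bilin_mull.
Qed.
Fact tensor_mulDl : left_distributive tensor_mul +%R.
Proof.
move=> s t r; apply: tensor_ext => W f hf.
by rewrite tensor_liftM // !tensor_liftD ?tensor_liftM //; apply: bilin_mulr_lift.
Qed.
Fact tensor_mulDr : right_distributive tensor_mul +%R.
Proof.
move=> s t r; apply: tensor_ext => W f hf.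
rewrite tensor_liftM // tensor_liftD // !tensor_liftM //.
rewrite /tensor_lift /sum_on -big_split; apply: eq_bigr => p _ /=.
exact: (tensor_liftD (bilin_mull hf _ _)).
Qed.

HB.instance Definition _ := GRing.Zmodule_isPzRing.Build T
  tensor_mulA tensor_mul1 tensor_mulr1 tensor_mulDl tensor_mulDr.

Lemma tensor_scaleAl c (s t : T) : c *: (s * t) = (c *: s) * t.
Proof.
apply: tensor_ext => W f hf.
rewrite tensor_liftM // !tensor_liftZ // ?tensor_liftM //; exact: bilin_mulr_lift.
Qed.
Lemma tensor_scaleAr c (s t : T) : c *: (s * t) = s * (c *: t).
Proof.
apply: tensor_ext => W f hf.
rewrite tensor_liftM // tensor_liftZ // tensor_liftM //.
rewrite {1 2}/tensor_lift /sum_on scaler_sumr; apply: eq_bigr => p _ /=.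
by rewrite tensor_liftZ //; apply: bilin_mull.
Qed.
Lemma pureM a b c d : (pure a b : T) * pure c d = pure (a * c) (b * d).
Proof.
apply: tensor_ext => W f hf; rewrite tensor_liftM //.
rewrite !tensor_lift_pure //; [exact: bilin_mull | exact: bilin_mulr_lift].
Qed.

End TensorRing.

(* Used only to show that the comultiplication respects x_i^(N_i). *)
Section QBinomial.
Variables (F : fieldType) (q : F).

Fixpoint qbin (n k : nat) : F :=
  match n, k with
  | _, 0%N => 1
  | 0%N, _.+1 => 0
  | n'.+1, k'.+1 => qbin n' k' + q ^+ k * qbin n' k
  end.

Lemma qbin0 n : qbin n 0 = 1. Proof. by case: n. Qed.

Lemma qbinS n k : qbin n.+1 k.+1 = qbin n k + q ^+ k.+1 * qbin n k.+1.
Proof. by []. Qed.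

Lemma qbin_small n k : (n < k)%N -> qbin n k = 0.
Proof.
elim: n k => [|n IH] [|k] //; rewrite ltnS => nk.
by rewrite qbinS !IH ?mulr0 ?addr0 // (ltn_trans nk).
Qed.

Lemma qbin_nn n : qbin n n = 1.
Proof. by elim: n => // n IH; rewrite qbinS IH qbin_small // mulr0 addr0. Qed.

Lemma qbin_mul n k :
  (1 - q ^+ k.+1) * qbin n.+1 k.+1 = (1 - q ^+ n.+1) * qbin n k.
Proof.
elim: n k => [|n IH] k.
  by case: k => [|k]; rewrite /= ?mulr0 ?addr0 ?mulr0.
rewrite qbinS mulrDr mulrCA IH; case: k => [|k].
  by rewrite !qbin0 (exprS q n.+1); ring.
have := IH k; rewrite qbinS => IHk.
apply/eqP; rewrite -subr_eq0; apply/eqP.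
rewrite (_ : _ - _ = q * ((1 - q ^+ k.+1) * (qbin n k + q ^+ k.+1 * qbin n k.+1) -
   (1 - q ^+ n.+1) * qbin n k)).
  by rewrite IHk subrr mulr0.
by rewrite (exprS q k.+1) (exprS q n.+1); ring.
Qed.

Local Arguments qbin : simpl never.

Lemma qbin_prim n k : n.-primitive_root q -> (0 < k < n)%N -> qbin n k = 0.
Proof.
case: k => // k; case: n => // n qn /= kn.
have := qbin_mul n k; rewrite (prim_expr_order qn) subrr mul0r => /eqP.
rewrite mulf_eq0 subr_eq0 eq_sym -(prim_order_dvd qn) => /orP[/dvdn_leq|/eqP//].
by move=> /(_ isT); rewrite leqNgt kn.
Qed.

Variables (T : pzRingType) (phi : F -> T).
Hypothesis phi1 : phi 1 = 1.
Hypothesis phiD : {morph phi : c d / c + d}.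
Hypothesis phiM : {morph phi : c d / c * d}.
Hypothesis phiC : forall c b, phi c * b = b * phi c.

Lemma phi0 : phi 0 = 0.
Proof. by apply: (addrI (phi 0)); rewrite -phiD !addr0. Qed.

Variables A B : T.
Hypothesis BA : B * A = phi q * (A * B).

Lemma qcommX k : B * A ^+ k = phi (q ^+ k) * (A ^+ k * B).
Proof.
elim: k => [|k IH]; first by rewrite !expr0 phi1 !mul1r mulr1.
rewrite (exprS A) (exprS q) phiM mulrA BA -!mulrA IH.
by rewrite (mulrA A) -(phiC _ A) -!mulrA.
Qed.

Lemma qbinomial n :
  (A + B) ^+ n = \sum_(k < n.+1) phi (qbin n k) * (A ^+ k * B ^+ (n - k)).
Proof.
elim: n => [|n IH].
  by rewrite big_ord1 qbin0 phi1 !mul1r.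
rewrite exprS IH mulrDl !mulr_sumr.
have -> : \sum_(i < n.+1) A * (phi (qbin n i) * (A ^+ i * B ^+ (n - i))) =
          \sum_(i < n.+1) phi (qbin n i) * (A ^+ i.+1 * B ^+ (n - i)).
  by apply: eq_bigr => i _; rewrite mulrA -phiC -mulrA (mulrA A) -exprS.
have -> : \sum_(i < n.+1) B * (phi (qbin n i) * (A ^+ i * B ^+ (n - i))) =
          \sum_(i < n.+1) phi (q ^+ i * qbin n i) * (A ^+ i * B ^+ (n.+1 - i)).
  apply: eq_bigr => i _; rewrite mulrA -phiC -mulrA (mulrA B) qcommX.
  rewrite subSn -1?ltnS // exprS phiM -!mulrA (mulrA (phi (qbin n i))).
  by rewrite phiC -!mulrA.
rewrite [in RHS]big_ord_recl [X in _ + X]big_ord_recl addrCA.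
congr (_ + _); first by rewrite !qbin0 expr0 !mul1r phi1 !mul1r !subn0.
under [in RHS]eq_bigr => i _ do rewrite lift0 qbinS phiD mulrDl subSS.
rewrite big_split /=; congr (_ + _).
rewrite [in RHS]big_ord_recr /= qbin_small // mulr0 phi0 mul0r addr0.
by apply: eq_bigr => i _; rewrite /bump /= add1n subSS.
Qed.

Lemma qbinomial_prim n : n.-primitive_root q -> (A + B) ^+ n = A ^+ n + B ^+ n.
Proof.
move=> qn; have n0 := prim_order_gt0 qn; rewrite qbinomial.
case: n n0 qn => // n _ qn.
rewrite big_ord_recl big_ord_recr /= big1 ?add0r => [|i _].
  rewrite /bump /= add1n qbin0 qbin_nn phi1 !mul1r subnn expr0.
  by rewrite mulr1 subn0 addrC.
by rewrite (qbin_prim qn) ?phi0 ?mul0r //= /bump /= add1n ltnS ltn_ord.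
Qed.

End QBinomial.

Definition is_character (F : fieldType) (G : finGroupType) (f : G -> F) : Prop :=
  (forall g, f g != 0) /\ {morph f : g h / (g * h)%g >-> g * h}.

(* Finite nontrivial abelian groups with |Hom(G, F\{0})| = |G|. *)
Record dual_full_group (F : fieldType) := DualFullGroup {
  dfg_group :> finGroupType;
  dfg_abelian : abelian [set: dfg_group];
  dfg_nontrivial : (1 < #|dfg_group|)%N;
  dfg_card_dual : exists s : seq {ffun dfg_group -> F},
    [/\ uniq s, size s = #|dfg_group|
      & forall f : {ffun dfg_group -> F}, f \in s <-> is_character f]
}.

Record qls_datum (F : fieldType) (G : dual_full_group F) (n : nat) := QlsDatum {
  qls_a : 'I_n -> G;
  qls_chi : 'I_n -> G -> F;
  qls_chiP : forall i, is_character (qls_chi i);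
  qls_q_neq1 : forall i, qls_chi i (qls_a i) != 1;
  qls_braid : forall i j, i != j ->
    qls_chi j (qls_a i) * qls_chi i (qls_a j) = 1
}.

Section Qls.
Variables (F : fieldType) (G : dual_full_group F) (n : nat) (R : qls_datum G n).

Definition qls_q (i : 'I_n) : F := qls_chi R i (qls_a R i).

Lemma character1 (f : G -> F) : is_character f -> f 1%g = 1.
Proof.
case=> nz fM; apply: (mulfI (nz 1%g)).
by rewrite -fM mulg1 mulr1.
Qed.

Lemma characterX (f : G -> F) g k : is_character f -> f (g ^+ k)%g = f g ^+ k.
Proof.
move=> hf; elim: k => [|k IH]; first exact: character1.
by rewrite expgS hf.2 IH exprS.
Qed.

Lemma qls_q_expG i : qls_q i ^+ #|G| = 1.
Proof.
rewrite /qls_q -(characterX _ _ (qls_chiP R i)) -cardsT.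
have /dvdnP[k ->] := order_dvdG (in_setT (qls_a R i)).
by rewrite mulnC expgM expg_order expg1n character1 //; apply: qls_chiP.
Qed.

Lemma dfg_card_gt0 : (0 < #|G|)%N.
Proof. exact: ltnW (dfg_nontrivial G). Qed.

(* The order of [q_i] in the multiplicative group of F. *)
Definition qls_N (i : 'I_n) : nat :=
  s2val (prim_order_exists dfg_card_gt0 (qls_q_expG i)).

Lemma qls_NP i : (qls_N i).-primitive_root (qls_q i).
Proof. exact: (s2valP (prim_order_exists dfg_card_gt0 (qls_q_expG i))). Qed.

(* [cd_lam i j] is only relevant for i < j. *)
Record compat_datum := CompatDatum {
  cd_mu : 'I_n -> bool;
  cd_lam : 'I_n -> 'I_n -> F;
  cd_muP : forall i,
    (qls_a R i ^+ qls_N i = 1)%g \/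
      ~ (forall g, qls_chi R i g ^+ qls_N i = 1) ->
    cd_mu i = false;
  cd_lamP : forall i j : 'I_n, (i < j)%N ->
    (qls_a R i * qls_a R j = 1)%g \/
      ~ (forall g, qls_chi R i g * qls_chi R j g = 1) ->
    cd_lam i j = 0
}.

End Qls.

Inductive expr (F : fieldType) (G : finGroupType) (n : nat) : Type :=
| EGrp of G
| EX of 'I_n
| EZero
| EOne
| EAdd of expr F G n & expr F G n
| EOpp of expr F G n
| EMul of expr F G n & expr F G n
| EScale of F & expr F G n.

Arguments EZero {F G n}.
Arguments EOne {F G n}.
Arguments EGrp {F G n}.
Arguments EX {F G n}.

Declare Scope expr_scope.
Delimit Scope expr_scope with E.
Bind Scope expr_scope with expr.
Notation "0" := EZero : expr_scope.
Notation "1" := EOne : expr_scope.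
Notation "x + y" := (EAdd x y) : expr_scope.
Notation "- x" := (EOpp x) : expr_scope.
Notation "x - y" := (EAdd x (EOpp y)) : expr_scope.
Notation "x * y" := (EMul x y) : expr_scope.
Notation "c *: x" := (EScale c x) : expr_scope.

Definition EPow F G n (x : expr F G n) (k : nat) : expr F G n :=
  iter k (EMul x) EOne.
Notation "x ^+ k" := (EPow x k) : expr_scope.

Section Presentation.
Variables (F : fieldType) (G : dual_full_group F) (n : nat).
Variables (R : qls_datum G n) (D : compat_datum R).
Local Notation a := (qls_a R).
Local Notation chi := (qls_chi R).
Local Notation N := (qls_N R).
Local Notation mu := (cd_mu D).
Local Notation lam := (cd_lam D).
Local Notation E := (expr F G n).

(* The smallest F-algebra congruence containing the defining relations. *)
Inductive presEq : E -> E -> Prop :=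
| pres_refl x : presEq x x
| pres_sym x y : presEq x y -> presEq y x
| pres_trans x y z : presEq x y -> presEq y z -> presEq x z
| pres_add x x' y y' : presEq x x' -> presEq y y' -> presEq (x + y)%E (x' + y')%E
| pres_opp x x' : presEq x x' -> presEq (- x)%E (- x')%E
| pres_mul x x' y y' : presEq x x' -> presEq y y' -> presEq (x * y)%E (x' * y')%E
| pres_scale c x x' : presEq x x' -> presEq (c *: x)%E (c *: x')%E
| pres_addA x y z : presEq (x + (y + z))%E (x + y + z)%E
| pres_addC x y : presEq (x + y)%E (y + x)%E
| pres_add0 x : presEq (0 + x)%E x
| pres_addN x : presEq (- x + x)%E 0%E
| pres_mulA x y z : presEq (x * (y * z))%E (x * y * z)%E
| pres_mul1x x : presEq (1 * x)%E x
| pres_mulx1 x : presEq (x * 1)%E x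
| pres_mulDl x y z : presEq ((x + y) * z)%E (x * z + y * z)%E
| pres_mulDr x y z : presEq (x * (y + z))%E (x * y + x * z)%E
| pres_scaleA c d x : presEq (c *: (d *: x))%E ((c * d)%R *: x)%E
| pres_scale1 x : presEq (1%R *: x)%E x
| pres_scaleDr c x y : presEq (c *: (x + y))%E (c *: x + c *: y)%E
| pres_scaleDl c d x : presEq ((c + d)%R *: x)%E (c *: x + d *: x)%E
| pres_scaleAl c x y : presEq (c *: (x * y))%E ((c *: x) * y)%E
| pres_scaleAr c x y : presEq (c *: (x * y))%E (x * (c *: y))%E
| pres_grp1 : presEq (EGrp 1%g) 1%E
| pres_grpM g h : presEq (EGrp (g * h)%g) (EGrp g * EGrp h)%E
| pres_grpX g i : presEq (EGrp g * EX i)%E (chi i g *: (EX i * EGrp g))%E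
| pres_pow i :
    presEq (EX i ^+ N i)%E ((mu i)%:R *: (1 - EGrp (a i ^+ N i)%g))%E
| pres_comm (i j : 'I_n) : (i < j)%N ->
    presEq (EX j * EX i)%E
           (chi i (a j) *: (EX i * EX j) + lam i j *: (1 - EGrp (a i * a j)%g))%E.

HB.instance Definition _ := gen_eqMixin E.
HB.instance Definition _ := gen_choiceMixin E.

Definition pres_rel (x y : E) : bool := `[< presEq x y >].

Lemma pres_rel_refl : reflexive pres_rel.
Proof. by move=> s; apply/asboolP; apply: pres_refl. Qed.
Lemma pres_rel_sym : symmetric pres_rel.
Proof. by move=> s t; apply/asboolP/asboolP; apply: pres_sym. Qed.
Lemma pres_rel_trans : transitive pres_rel.
Proof.
by move=> t s r /asboolP st /asboolP tr; apply/asboolP; apply: pres_trans st tr.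
Qed.
Canonical pres_equiv :=
  EquivRel pres_rel pres_rel_refl pres_rel_sym pres_rel_trans.

Definition PGRD : Type := {eq_quot pres_equiv}.

HB.instance Definition _ := Choice.on PGRD.
HB.instance Definition _ := EqQuotient.on PGRD.

Local Notation cls := (\pi_PGRD).

Lemma pres_clsP x y : cls x = cls y <-> presEq x y.
Proof. by split=> [/eqmodP/asboolP | h]; last apply/eqmodP/asboolP. Qed.

Lemma pres_repr x : presEq (repr (cls x)) x.
Proof. by apply/pres_clsP; rewrite reprK. Qed.

Definition pgrd_zero : PGRD := cls 0%E.
Definition pgrd_one : PGRD := cls 1%E.
Definition pgrd_add (x y : PGRD) : PGRD := cls (repr x + repr y)%E.
Definition pgrd_opp (x : PGRD) : PGRD := cls (- repr x)%E.
Definition pgrd_mul (x y : PGRD) : PGRD := cls (repr x * repr y)%E.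
Definition pgrd_scale (c : F) (x : PGRD) : PGRD := cls (c *: repr x)%E.

Lemma clsD x y : cls (x + y)%E = pgrd_add (cls x) (cls y).
Proof. by apply/pres_clsP/pres_add; apply/pres_sym/pres_repr. Qed.
Lemma clsN x : cls (- x)%E = pgrd_opp (cls x).
Proof. by apply/pres_clsP/pres_opp; apply/pres_sym/pres_repr. Qed.
Lemma clsM x y : cls (x * y)%E = pgrd_mul (cls x) (cls y).
Proof. by apply/pres_clsP/pres_mul; apply/pres_sym/pres_repr. Qed.
Lemma clsZ c x : cls (c *: x)%E = pgrd_scale c (cls x).
Proof. by apply/pres_clsP/pres_scale; apply/pres_sym/pres_repr. Qed.

Lemma clsE (x : PGRD) : exists e, x = cls e.
Proof. by exists (repr x); rewrite reprK. Qed.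

Fact pgrd_addA : associative pgrd_add.
Proof.
move=> x y z; have [[x' ->] [y' ->] [z' ->]] := And3 (clsE x) (clsE y) (clsE z).
by rewrite -!clsD; apply/pres_clsP; constructor.
Qed.
Fact pgrd_addC : commutative pgrd_add.
Proof.
move=> x y; have [[x' ->] [y' ->]] := conj (clsE x) (clsE y).
by rewrite -!clsD; apply/pres_clsP; constructor.
Qed.
Fact pgrd_add0 : left_id pgrd_zero pgrd_add.
Proof.
by move=> x; have [x' ->] := clsE x; rewrite -!clsD; apply/pres_clsP; constructor.
Qed.
Fact pgrd_addN : left_inverse pgrd_zero pgrd_opp pgrd_add.
Proof.
by move=> x; have [x' ->] := clsE x; rewrite -clsN -clsD; apply/pres_clsP; constructor.
Qed.
HB.instance Definition _ := GRing.isZmodule.Build PGRD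
  pgrd_addA pgrd_addC pgrd_add0 pgrd_addN.

Fact pgrd_mulA : associative pgrd_mul.
Proof.
move=> x y z; have [[x' ->] [y' ->] [z' ->]] := And3 (clsE x) (clsE y) (clsE z).
by rewrite -!clsM; apply/pres_clsP; constructor.
Qed.
Fact pgrd_mul1 : left_id pgrd_one pgrd_mul.
Proof.
by move=> x; have [x' ->] := clsE x; rewrite -!clsM; apply/pres_clsP; constructor.
Qed.
Fact pgrd_mulr1 : right_id pgrd_one pgrd_mul.
Proof.
by move=> x; have [x' ->] := clsE x; rewrite -!clsM; apply/pres_clsP; constructor.
Qed.
Fact pgrd_mulDl : left_distributive pgrd_mul +%R.
Proof.
move=> x y z; have [[x' ->] [y' ->] [z' ->]] := And3 (clsE x) (clsE y) (clsE z).
by rewrite /GRing.add /= -(clsD x' y') -!clsM -clsD; apply/pres_clsP; constructor.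
Qed.
Fact pgrd_mulDr : right_distributive pgrd_mul +%R.
Proof.
move=> x y z; have [[x' ->] [y' ->] [z' ->]] := And3 (clsE x) (clsE y) (clsE z).
by rewrite /GRing.add /= -(clsD y' z') -!clsM -clsD; apply/pres_clsP; constructor.
Qed.
HB.instance Definition _ := GRing.Zmodule_isPzRing.Build PGRD
  pgrd_mulA pgrd_mul1 pgrd_mulr1 pgrd_mulDl pgrd_mulDr.

Fact pgrd_scaleA c d x : pgrd_scale c (pgrd_scale d x) = pgrd_scale (c * d) x.
Proof.
by have [x' ->] := clsE x; rewrite -!clsZ; apply/pres_clsP; constructor.
Qed.
Fact pgrd_scale1 : left_id 1 pgrd_scale.
Proof.
by move=> x; have [x' ->] := clsE x; rewrite -!clsZ; apply/pres_clsP; constructor.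
Qed.
Fact pgrd_scaleDr : right_distributive pgrd_scale +%R.
Proof.
move=> c x y; have [[x' ->] [y' ->]] := conj (clsE x) (clsE y).
by rewrite /GRing.add /= -(clsD x' y') -!clsZ -clsD; apply/pres_clsP; constructor.
Qed.
Fact pgrd_scaleDl x : {morph pgrd_scale^~ x : c d / c + d}.
Proof.
move=> c d; have [x' ->] := clsE x.
by rewrite [in RHS]/GRing.add /= -!clsZ -!clsD; apply/pres_clsP; constructor.
Qed.
HB.instance Definition _ := GRing.Zmodule_isLmodule.Build F PGRD
  pgrd_scaleA pgrd_scale1 pgrd_scaleDr pgrd_scaleDl.

Lemma pgrd_clsD x y : cls (x + y)%E = cls x + cls y.
Proof. exact: clsD. Qed.
Lemma pgrd_clsN x : cls (- x)%E = - cls x.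
Proof. exact: clsN. Qed.
Lemma pgrd_clsM x y : cls (x * y)%E = cls x * cls y.
Proof. exact: clsM. Qed.
Lemma pgrd_clsZ c x : cls (c *: x)%E = c *: cls x.
Proof. exact: clsZ. Qed.
Lemma pgrd_clsX x k : cls (x ^+ k)%E = cls x ^+ k.
Proof. by elim: k => // k IH; rewrite exprS -IH -pgrd_clsM. Qed.

Definition pgrd_clsE := (pgrd_clsD, pgrd_clsN, pgrd_clsM, pgrd_clsZ, pgrd_clsX).

Definition pgrd_grp (g : G) : PGRD := cls (EGrp g).
Definition pgrd_x (i : 'I_n) : PGRD := cls (EX i).

Section Eval.
Variables (B : pzRingType) (phi : F -> B) (f : G -> B) (y : 'I_n -> B).

Fixpoint eval (e : E) : B :=
  match e with
  | EGrp g => f g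
  | EX i => y i
  | EZero => 0
  | EOne => 1
  | EAdd e1 e2 => eval e1 + eval e2
  | EOpp e1 => - eval e1
  | EMul e1 e2 => eval e1 * eval e2
  | EScale c e1 => phi c * eval e1
  end.

Hypothesis phi1 : phi 1 = 1.
Hypothesis phiD : {morph phi : c d / c + d}.
Hypothesis phiM : {morph phi : c d / c * d}.
Hypothesis phiC : forall c b, phi c * b = b * phi c.
Hypothesis f1 : f 1%g = 1.
Hypothesis fM : {morph f : g h / (g * h)%g >-> g * h}.
Hypothesis fy : forall g i, f g * y i = phi (chi i g) * (y i * f g).
Hypothesis yN : forall i, y i ^+ N i = phi (mu i)%:R * (1 - f (a i ^+ N i)%g).
Hypothesis yy : forall i j : 'I_n, (i < j)%N ->
  y j * y i = phi (chi i (a j)) * (y i * y j) + phi (lam i j) * (1 - f (a i * a j)%g).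

Lemma eval_pow e k : eval (e ^+ k)%E = eval e ^+ k.
Proof. by elim: k => //= k ->; rewrite exprS. Qed.

Lemma eval_presEq e e' : presEq e e' -> eval e = eval e'.
Proof.
elim=> {e e'} //=.
- by move=> x y' z _ -> _ ->.
- by move=> x x' y0 y' _ -> _ ->.
- by move=> x x' _ ->.
- by move=> x x' y0 y' _ -> _ ->.
- by move=> c x x' _ ->.
- by move=> *; rewrite addrA.
- by move=> *; rewrite addrC.
- by move=> *; rewrite add0r.
- by move=> *; rewrite addNr.
- by move=> *; rewrite mulrA.
- by move=> *; rewrite mul1r.
- by move=> *; rewrite mulr1.
- by move=> *; rewrite mulrDl.
- by move=> *; rewrite mulrDr.
- by move=> *; rewrite phiM mulrA.
- by move=> *; rewrite phi1 mul1r.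
- by move=> *; rewrite mulrDr.
- by move=> *; rewrite phiD mulrDl.
- by move=> *; rewrite mulrA.
- by move=> c x z; rewrite !mulrA phiC.
- by move=> i; rewrite eval_pow yN.
Qed.

Lemma eval_repr e : eval (repr (cls e)) = eval e.
Proof. exact/eval_presEq/pres_repr. Qed.

End Eval.

Definition counit_expr : E -> F := eval id (fun _ => 1) (fun _ => 0).

Lemma counit_exprP e e' : presEq e e' -> counit_expr e = counit_expr e'.
Proof.
apply: eval_presEq => // [c b|g h|g i|i|i j _]; rewrite ?subrr ?mul0r ?mulr0 //.
- by rewrite mulrC.
- by rewrite mul1r.
- by rewrite expr0n gtn_eqF // (prim_order_gt0 (qls_NP R i)).
- by rewrite addr0.
Qed.

Definition counit (h : PGRD) : F := counit_expr (repr h).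

Lemma counit_cls e : counit (cls e) = counit_expr e.
Proof. exact/counit_exprP/pres_repr. Qed.

Fact pgrd_oner_neq0 : (1 : PGRD) != 0.
Proof.
apply/eqP => /(congr1 counit) /eqP; rewrite !counit_cls /counit_expr /=.
by rewrite oner_eq0.
Qed.
HB.instance Definition _ :=
  GRing.PzSemiRing_isNonZero.Build PGRD pgrd_oner_neq0.

Fact pgrd_scaleAl c (x y : PGRD) : c *: (x * y) = (c *: x) * y.
Proof.
have [[x' ->] [y' ->]] := conj (clsE x) (clsE y).
by have /pres_clsP := pres_scaleAl c x' y'; rewrite !pgrd_clsE.
Qed.
Fact pgrd_scaleAr c (x y : PGRD) : c *: (x * y) = x * (c *: y).
Proof.
have [[x' ->] [y' ->]] := conj (clsE x) (clsE y).
by have /pres_clsP := pres_scaleAr c x' y'; rewrite !pgrd_clsE.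
Qed.
HB.instance Definition _ := GRing.Lmodule_isLalgebra.Build F PGRD pgrd_scaleAl.
HB.instance Definition _ := GRing.Lalgebra_isAlgebra.Build F PGRD pgrd_scaleAr.


Lemma pgrd_grp1 : pgrd_grp 1%g = 1.
Proof. by apply/pres_clsP; constructor. Qed.
Lemma pgrd_grpM g h : pgrd_grp (g * h)%g = pgrd_grp g * pgrd_grp h.
Proof. by have /pres_clsP := pres_grpM g h; rewrite !pgrd_clsE. Qed.
Lemma pgrd_grpx g i : pgrd_grp g * pgrd_x i = chi i g *: (pgrd_x i * pgrd_grp g).
Proof. by have /pres_clsP := pres_grpX g i; rewrite !pgrd_clsE. Qed.
Lemma pgrd_xN i : pgrd_x i ^+ N i = (mu i)%:R *: (1 - pgrd_grp (a i ^+ N i)%g).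
Proof.
by have /pres_clsP := pres_pow i; rewrite !pgrd_clsE.
Qed.
Lemma pgrd_xx (i j : 'I_n) : (i < j)%N ->
  pgrd_x j * pgrd_x i =
  chi i (a j) *: (pgrd_x i * pgrd_x j) + lam i j *: (1 - pgrd_grp (a i * a j)%g).
Proof.
by move=> ij; have /pres_clsP := pres_comm ij; rewrite !pgrd_clsE.
Qed.

Local Notation HH := (tensor PGRD PGRD).

Definition comul_grp (g : G) : HH := pure (pgrd_grp g) (pgrd_grp g).
Definition comul_x (i : 'I_n) : HH :=
  pure (pgrd_x i) 1 + pure (pgrd_grp (a i)) (pgrd_x i).

Local Notation phi := (fun c : F => c *: (1 : HH)).

Definition comul_expr : E -> HH := eval phi comul_grp comul_x.

Fact comul_phi1 : phi 1 = 1.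
Proof. exact: scale1r. Qed.
Fact comul_phiD : {morph phi : c d / c + d}.
Proof. by move=> c d; rewrite scalerDl. Qed.
Fact comul_phiE c (t : HH) : phi c * t = c *: t.
Proof. by rewrite -tensor_scaleAl mul1r. Qed.
Fact comul_phiM : {morph phi : c d / c * d}.
Proof. by move=> c d; rewrite comul_phiE scalerA. Qed.
Fact comul_phiC c (t : HH) : phi c * t = t * phi c.
Proof. by rewrite comul_phiE -tensor_scaleAr mulr1. Qed.

Fact pgrd_grpC g h : pgrd_grp g * pgrd_grp h = pgrd_grp h * pgrd_grp g.
Proof.
rewrite -!pgrd_grpM; congr pgrd_grp.
by apply: (centsP (dfg_abelian G)); rewrite inE.
Qed.

Fact pgrd_grpXn g k : pgrd_grp (g ^+ k)%g = pgrd_grp g ^+ k.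
Proof.
elim: k => [|k IH]; first exact: pgrd_grp1.
by rewrite expgS pgrd_grpM IH exprS.
Qed.

Let pZl := bilinZl (@pure_bilinear F PGRD PGRD).
Let pZr := bilinZr (@pure_bilinear F PGRD PGRD).
Let pDl := bilinDl (@pure_bilinear F PGRD PGRD).
Let pDr := bilinDr (@pure_bilinear F PGRD PGRD).

Let pNl u v : pure (- u) v = - pure u v :> HH.
Proof. by rewrite -scaleN1r pZl scaleN1r. Qed.
Let pNr u v : pure u (- v) = - pure u v :> HH.
Proof. by rewrite -scaleN1r pZr scaleN1r. Qed.

Fact pureX (u v : PGRD) k : (pure u v : HH) ^+ k = pure (u ^+ k) (v ^+ k).
Proof. by elim: k => // k IH; rewrite !exprS IH pureM. Qed.

Fact comul_grp_x g i :
  comul_grp g * comul_x i = phi (chi i g) * (comul_x i * comul_grp g).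
Proof.
rewrite comul_phiE /comul_grp /comul_x mulrDl mulrDr !pureM !mul1r !mulr1.
by rewrite !pgrd_grpx pZl pZr scalerDr (pgrd_grpC g).
Qed.

Fact comul_x_N i :
  comul_x i ^+ N i = phi (mu i)%:R * (1 - comul_grp (a i ^+ N i)%g).
Proof.
rewrite comul_phiE /comul_x.
rewrite (qbinomial_prim comul_phi1 comul_phiD comul_phiM comul_phiC _ (qls_NP R i)).
  rewrite !pureX pgrd_xN expr1n pgrd_grpXn pZl pZr -scalerDr; congr (_ *: _).
  rewrite pDl pDr pNl pNr -addrA; congr (_ + _).
  by rewrite addrA addNr add0r /comul_grp pgrd_grpXn.
by rewrite !pureM !mul1r !mulr1 pgrd_grpx pZl comul_phiE.
Qed.

Fact comul_xx (i j : 'I_n) : (i < j)%N ->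
  comul_x j * comul_x i =
  phi (chi i (a j)) * (comul_x i * comul_x j)
    + phi (lam i j) * (1 - comul_grp (a i * a j)%g).
Proof.
move=> ij; rewrite !comul_phiE /comul_x !mulrDl !mulrDr !pureM !mul1r !mulr1.
rewrite (pgrd_grpx (a j) i) (pgrd_grpx (a i) j) !(pgrd_xx ij).
rewrite (pgrd_grpC (a j) (a i)) !(pDl, pDr, pZl, pZr, pNl, pNr) -pgrd_grpM.
rewrite !scalerDr !scalerA.
have -> : chi i (a j) * chi j (a i) = 1.
  by rewrite mulrC qls_braid // -val_eqE /= neq_ltn ij.
rewrite scale1r mulrN1 !scaleNr /comul_grp !addrA.
by rewrite [LHS](ACl (1*5*4*6*2*8*(3*7)))/= addNr addr0.
Qed.

Lemma comul_exprP e e' : presEq e e' -> comul_expr e = comul_expr e'.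
Proof.
apply: eval_presEq.
- exact: comul_phi1.
- exact: comul_phiD.
- exact: comul_phiM.
- exact: comul_phiC.
- by rewrite /comul_grp pgrd_grp1.
- by move=> g h; rewrite /comul_grp pgrd_grpM pureM.
- exact: comul_grp_x.
- exact: comul_x_N.
- exact: comul_xx.
Qed.

(* Well defined on classes by [comul_exprP]. *)
Definition comul (h : PGRD) : HH := comul_expr (repr h).

Lemma comul_cls e : comul (cls e) = comul_expr e.
Proof. exact/comul_exprP/pres_repr. Qed.

Lemma comul_grpE g : comul (pgrd_grp g) = pure (pgrd_grp g) (pgrd_grp g).
Proof. exact: comul_cls. Qed.
Lemma comul_xE i :
  comul (pgrd_x i) = pure (pgrd_x i) 1 + pure (pgrd_grp (a i)) (pgrd_x i).
Proof. exact: comul_cls. Qed.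
Lemma comul_monoid_morphism : monoid_morphism comul.
Proof.
split=> [|x y]; first exact: comul_cls.
by have [[x' ->] [y' ->]] := conj (clsE x) (clsE y); rewrite -pgrd_clsM !comul_cls.
Qed.
Lemma comul_linear : linear comul.
Proof.
move=> c x y; have [[x' ->] [y' ->]] := conj (clsE x) (clsE y).
by rewrite -pgrd_clsZ -pgrd_clsD !comul_cls -comul_phiE.
Qed.

Lemma counit_grpE g : counit (pgrd_grp g) = 1.
Proof. exact: counit_cls. Qed.
Lemma counit_xE i : counit (pgrd_x i) = 0.
Proof. exact: counit_cls. Qed.
Lemma counit_monoid_morphism : monoid_morphism counit.
Proof.
split=> [|x y]; first exact: counit_cls.
by have [[x' ->] [y' ->]] := conj (clsE x) (clsE y); rewrite -pgrd_clsM !counit_cls.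
Qed.
Lemma counit_linear : scalar counit.
Proof.
move=> c x y; have [[x' ->] [y' ->]] := conj (clsE x) (clsE y).
by rewrite -pgrd_clsZ -pgrd_clsD !counit_cls.
Qed.

(* The Sweedler sum of [beta h_(1) h_(2)]; meaningful for bilinear [beta]. *)
Definition sweedler (V : lmodType F) (beta : PGRD -> PGRD -> V) (h : PGRD) : V :=
  tensor_lift beta (comul h).

Section Action.
Variable A : algType F.

Record module_algebra (act : PGRD -> A -> A) : Prop := ModuleAlgebra {
  act_bilinear : bilinear_map act;
  act1 : forall b, act 1 b = b;
  actM : forall h k b, act (h * k) b = act h (act k b);
  act_mul : forall h b c,
    act h (b * c) = sweedler (fun h1 h2 => act h1 b * act h2 c) h;
  act_one : forall h, act h 1 = (counit h)%:A
}.

Definition convolution_inverse (u v : {linear PGRD -> A}) : Prop :=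
  forall h,
    sweedler (fun h1 h2 => u h1 * v h2) h = (counit h)%:A /\
    sweedler (fun h1 h2 => v h1 * u h2) h = (counit h)%:A.

Definition inner_via (act : PGRD -> A -> A) (u : {linear PGRD -> A}) : Prop :=
  u 1 = 1 /\
  exists v : {linear PGRD -> A}, convolution_inverse u v /\
    forall h b, act h b = sweedler (fun h1 h2 => u h1 * b * v h2) h.

End Action.

End Presentation.

(* Main.v *)
(* Put y_i = u(x_i), g_i = u(a_i), so that x_i acts as the skew derivation
   b |-> y_i b - (a_i * b) y_i.  If z b = (g b g^-1) z for all b, then g^-1 z is
   central, hence z is a scalar multiple of g.  Applied to the relation
   a_j x_i = chi_i(a_j) x_i a_j, this gives a_j * y_i = chi_i(a_j) y_i + s g_i;
   the terms in s cancel in x_j * (x_i * b), and the commutation relation of x_i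
   and x_j then says that
   z = y_j y_i - chi_i(a_j) y_i y_j - lambda_ij satisfies
   z b = (a_i a_j * b) z. *)
Require Import Defs.
From mathcomp Require Import all_boot all_order all_algebra all_fingroup.

Set Implicit Arguments.
Unset Strict Implicit.
Unset Printing Implicit Defensive.

Import GRing.Theory.
Local Open Scope ring_scope.

(** Bookkeeping for [inner_commutator]: [R] and [T] are the terms with [b] between two
    skew-primitive factors. They occur in both expansions, in opposite order, and cancel. *)
Lemma zmod_cancel2 (V : zmodType) (P R T S Q S' L N : V) :
  P - R - T + S = Q - T - R + S' + (L - N) -> P - Q - L = S' - S - N.
Proof.
rewrite [LHS](ACl (1*4*2*3)) [RHS](ACl (1*4*5*3*2)) => /addIr/addIr /= E.
rewrite -[P](addrK S) E addrA [LHS](ACl ((1*6)*(3*7)*(2*5*4))) /=.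
by rewrite !subrr !add0r.
Qed.

Lemma central_mx_scalar (S : comPzRingType) (m : nat) (M : 'M[S]_m.+1) :
  (forall B, M *m B = B *m M) -> M = (M 0 0)%:M.
Proof.
move=> MC; apply/matrixP => i j.
(* Entry (i, 0) of M E_{j0} is M_ij, and that of E_{j0} M is M_00 if i = j and 0 otherwise. *)
have /matrixP/(_ i 0) := MC (delta_mx j 0).
rewrite !mxE (bigD1 j) //= [X in _ = X](bigD1 0) //= !mxE !eqxx andbT mulr1.
rewrite big1 => [|k /negbTE kj]; last by rewrite mxE kj mulr0.
rewrite big1 => [|k /negbTE k0]; last by rewrite mxE k0 andbF mul0r.
by rewrite !addr0 andbT mulr_natl.
Qed.

Lemma conj_intertwiner_scalar (S : comNzRingType) (m : nat)
    (g g' z : 'M[S]_m.+1) :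
  g * g' = 1 -> g' * g = 1 -> (forall b, z * b = g * b * g' * z) ->
  exists c : S, z = c *: g.
Proof.
move=> gg' g'g zb.
have g'zC b : g' * z *m b = b *m (g' * z).
  by rewrite -[LHS]/(g' * z * b) -[RHS]/(b * (g' * z)) -mulrA zb !mulrA g'g mul1r.
exists ((g' * z) 0 0); rewrite -[z in LHS]mul1r -gg' -mulrA.
by rewrite {1}(central_mx_scalar g'zC) [LHS]mul_mx_scalar.
Qed.

(** To be read with [al], [be] the actions of a_i, a_j, with [y] = y_i, [g] = g_i and [z] = y_j.
    Expanding [be y] yields the terms s g (be b) and s be(al b) g; they agree because [g]
    intertwines [al] and [al] commutes with [be]. *)
Lemma skew_derivation_comp (S : comNzRingType) (A : algType S)
    (al be : A -> A) (g y z : A) (c s : S) :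
  {morph be : b1 b2 / b1 - b2} -> {morph be : b1 b2 / b1 * b2} ->
  (forall b, g * b = al b * g) -> (forall b, be (al b) = al (be b)) ->
  be y = c *: y + s *: g ->
  forall b, z * (y * b - al b * y) - be (y * b - al b * y) * z =
    z * y * b - z * al b * y - c *: (y * be b * z) + c *: (be (al b) * y * z).
Proof.
move=> beB beM gal beal bey b.
have -> : be (y * b - al b * y) = c *: (y * be b) - c *: (be (al b) * y).
  rewrite beB !beM bey mulrDl mulrDr -!scalerAl -!scalerAr gal beal.
  by rewrite opprD addrACA subrr addr0.
by rewrite mulrBr mulrBl -!scalerAl opprB !mulrA [X in _ + X = _]addrC addrA.
Qed.

Section InnerAction.
Variables (F : fieldType) (G : dual_full_group F) (n : nat).
Variables (R : qls_datum G n) (D : compat_datum R).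
Local Notation H := (PGRD D).
Local Notation grp := (pgrd_grp D).
Local Notation x := (pgrd_x D).
Local Notation a := (qls_a R).
Local Notation chi := (qls_chi R).
Local Notation lam := (cd_lam D).

Lemma sweedler_grp (V : lmodType F) (beta : H -> H -> V) g :
  bilinear_map beta -> sweedler beta (grp g) = beta (grp g) (grp g).
Proof. by move=> hb; rewrite /sweedler comul_grpE tensor_lift_pure. Qed.

Lemma sweedler_x (V : lmodType F) (beta : H -> H -> V) i :
  bilinear_map beta ->
  sweedler beta (x i) = beta (x i) 1 + beta (grp (a i)) (x i).
Proof.
move=> hb; rewrite /sweedler comul_xE.
by rewrite [LHS](tensor_liftD hb) !tensor_lift_pure.
Qed.

Section Algebra.
Variables (A : algType F) (act : H -> A -> A) (u v : {linear H -> A}).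

Lemma bilinear_mulrr (w w' : {linear H -> A}) (b : A) :
  bilinear_map (fun h k => w h * b * w' k).
Proof.
split=> [k|h] c y z; rewrite linearP; first by rewrite !mulrDl -!scalerAl.
by rewrite mulrDr -scalerAr.
Qed.

Lemma bilinear_mulr (w w' : {linear H -> A}) :
  bilinear_map (fun h k => w h * w' k).
Proof.
split=> [k|h] c y z; rewrite linearP; first by rewrite mulrDl -scalerAl.
by rewrite mulrDr -scalerAr.
Qed.

Hypothesis u1 : u 1 = 1.
Hypothesis uv : convolution_inverse u v.
Hypothesis actE : forall h b, act h b = sweedler (fun k l => u k * b * v l) h.

Lemma conv_mul_grp g : u (grp g) * v (grp g) = 1.
Proof.
have [+ _] := uv (grp g); rewrite counit_grpE scale1r sweedler_grp //.
exact: bilinear_mulr.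
Qed.

Lemma conv_grp_mul g : v (grp g) * u (grp g) = 1.
Proof.
have [_] := uv (grp g); rewrite counit_grpE scale1r sweedler_grp //.
exact: bilinear_mulr.
Qed.

Lemma conv_inverse1 : v 1 = 1.
Proof. by have := conv_mul_grp 1%g; rewrite pgrd_grp1 u1 mul1r. Qed.

(** Since x_i has counit 0, evaluating u * v = eps at x_i leaves u(x_i) + u(a_i) v(x_i) = 0;
    multiply by v(a_i) on the left. *)
Lemma conv_inverse_x i : v (x i) = - (v (grp (a i)) * u (x i)).
Proof.
have [+ _] := uv (x i); rewrite counit_xE scale0r sweedler_x; last first.
  exact: bilinear_mulr.
rewrite conv_inverse1 mulr1 => /eqP; rewrite addr_eq0 => /eqP ->.
by rewrite mulrN opprK mulrA conv_grp_mul mul1r.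
Qed.

Lemma inner_grp g b : act (grp g) b = u (grp g) * b * v (grp g).
Proof. by rewrite actE sweedler_grp //; apply: bilinear_mulrr. Qed.

Lemma inner_x i b : act (x i) b = u (x i) * b - act (grp (a i)) b * u (x i).
Proof.
rewrite actE sweedler_x; last exact: bilinear_mulrr.
by rewrite conv_inverse1 mulr1 conv_inverse_x inner_grp mulrN !mulrA.
Qed.

Lemma inner_grpB g : {morph act (grp g) : b c / b - c}.
Proof. by move=> b c; rewrite !inner_grp mulrBr mulrBl. Qed.

Lemma inner_grpM g : {morph act (grp g) : b c / b * c}.
Proof.
move=> b c; rewrite !inner_grp !mulrA; congr (_ * _ * _).
by rewrite -[RHS]mulrA conv_grp_mul mulr1.
Qed.

Lemma mul_grp_inner g b : u (grp g) * b = act (grp g) b * u (grp g).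
Proof. by rewrite inner_grp -[RHS]mulrA conv_grp_mul mulr1. Qed.

End Algebra.

Section Matrix.
Variables (m : nat) (act : H -> 'M[F]_m.+1 -> 'M[F]_m.+1).
Variables u v : {linear H -> 'M[F]_m.+1}.
Hypothesis u1 : u 1 = 1.
Hypothesis uv : convolution_inverse u v.
Hypothesis actE : forall h b, act h b = sweedler (fun k l => u k * b * v l) h.
Hypothesis act1 : forall b, act 1 b = b.
Hypothesis act_bilin : bilinear_map act.
Hypothesis actM : forall h k b, act (h * k) b = act h (act k b).

Let act_grp g := inner_grp actE g.
Let act_x i := inner_x u1 uv actE i.

Lemma inner_grp_comm g h b :
  act (grp g) (act (grp h) b) = act (grp h) (act (grp g) b).
Proof. by rewrite -!actM pgrd_grpC. Qed.

Lemma inner_grp_ux g i :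
  exists s : F, act (grp g) (u (x i)) = chi i g *: u (x i) + s *: u (grp (a i)).
Proof.
pose z := act (grp g) (u (x i)) - chi i g *: u (x i).
suff [s zs] : exists s, z = s *: u (grp (a i)).
  by exists s; rewrite -zs addrC subrK.
apply: (conj_intertwiner_scalar (conv_mul_grp uv _) (conv_grp_mul uv _)) => c.
rewrite -act_grp.
(* The action of g is onto, so the test element may be taken as c = g * b. Then g x_i = chi_i(g) x_i
   g, applied to b, becomes z c = (a_i * c) z. *)
have [b ->] : exists b, c = act (grp g) b.
  by exists (act (grp g^-1) c); rewrite -actM -pgrd_grpM mulgV pgrd_grp1 act1.
have := congr1 (act^~ b) (pgrd_grpx D g i) => /=.
rewrite actM (bilinZl act_bilin) actM !act_x (inner_grpB actE).
rewrite !(inner_grpM uv actE) (inner_grp_comm g) scalerBr => E.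
rewrite mulrBl mulrBr -scalerAl -scalerAr.
by apply/eqP; rewrite subr_eq -addrA [X in _ + X]addrC -E addrC subrK.
Qed.

(** Stated for arbitrary i and j, so that it expands both x_j x_i and x_i x_j in the commutation
    relation. *)
Lemma inner_xx (i j : 'I_n) b :
  act (x j * x i) b =
    u (x j) * u (x i) * b - u (x j) * act (grp (a i)) b * u (x i)
    - chi i (a j) *: (u (x i) * act (grp (a j)) b * u (x j))
    + chi i (a j) *: (act (grp (a i * a j)%g) b * u (x i) * u (x j)).
Proof.
have [s hs] := inner_grp_ux (a j) i.
rewrite actM [act (x i) b]act_x act_x.
rewrite (@skew_derivation_comp _ _ (act (grp (a i))) _ _ _ _ _ _
  (inner_grpB actE (a j)) (inner_grpM uv actE (a j)) _ _ hs).
- by rewrite inner_grp_comm -actM pgrd_grpM.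
- exact: (mul_grp_inner uv actE).
- exact: inner_grp_comm.
Qed.

Lemma inner_commutator (i j : 'I_n) : (i < j)%N ->
  exists zeta : F,
    u (x j) * u (x i) - chi i (a j) *: (u (x i) * u (x j))
    = lam i j *: 1 + zeta *: (u (grp (a i)) * u (grp (a j))).
Proof.
move=> ij.
(* After scaling the expansion of x_i x_j by chi_i(a_j), this turns the coefficients of its last two
   terms into 1, as the cancellation requires. *)
have ij' : chi i (a j) * chi j (a i) = 1.
  by rewrite mulrC qls_braid // -val_eqE /= neq_ltn ij.
pose w := u (x j) * u (x i) - chi i (a j) *: (u (x i) * u (x j)).
suff [z hz] : exists z, w - lam i j *: 1 = z *: (u (grp (a i)) * u (grp (a j))).
  by exists z; rewrite -hz [RHS]addrC subrK.
pose g := u (grp (a i)) * u (grp (a j)).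
pose g' := v (grp (a j)) * v (grp (a i)).
have gg' : g * g' = 1.
  by rewrite /g /g' -mulrA (mulrA (u (grp (a j)))) (conv_mul_grp uv) mul1r
    (conv_mul_grp uv).
have g'g : g' * g = 1.
  by rewrite /g /g' -mulrA (mulrA (v (grp (a i)))) (conv_grp_mul uv) mul1r
    (conv_grp_mul uv).
apply: (conj_intertwiner_scalar gg' g'g) => b.
(* [u] is not assumed multiplicative, but conjugation by u(a_i) u(a_j) is still the action of a_i
   a_j. *)
have -> : g * b * g' = act (grp (a i * a j)%g) b.
  by rewrite pgrd_grpM actM !act_grp /g /g' !mulrA.
have := congr1 (act^~ b) (pgrd_xx D ij) => /=.
rewrite (bilinDl act_bilin) !(bilinZl act_bilin) (bilinDl act_bilin).
(* The sign is written as a scalar so that linearity of the action in its first argument applies to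
   1 - a_i a_j. *)
rewrite -scaleN1r (bilinZl act_bilin) scaleN1r !inner_xx.
rewrite [grp (a j * a i)%g]pgrd_grpM (pgrd_grpC D (a j)) -pgrd_grpM act1.
rewrite !scalerDr !scalerN !scalerA ij' !scale1r.
move=> /zmod_cancel2 E.
rewrite !(mulrBl, mulrBr) -!(scalerAl, scalerAr) mul1r mulr1 !mulrA.
exact: E.
Qed.

End Matrix.
End InnerAction.

Theorem theorem5p6 (F : fieldType) (G : dual_full_group F) (n : nat)
    (R : qls_datum G n) (D : compat_datum R) (m : nat)
    (act : PGRD D -> 'M[F]_m.+1 -> 'M[F]_m.+1)
    (u : {linear PGRD D -> 'M[F]_m.+1}) :
  module_algebra act -> inner_via act u ->
  forall i j : 'I_n, (i < j)%N ->
  exists zeta : F,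
    u (pgrd_x D j) * u (pgrd_x D i)
      - qls_chi R i (qls_a R j) *: (u (pgrd_x D i) * u (pgrd_x D j))
    = cd_lam D i j *: 1
      + zeta *: (u (pgrd_grp D (qls_a R i)) * u (pgrd_grp D (qls_a R j))).
Proof.
by case=> bl a1 aM _ _ [u1 [v [uv aE]]]; apply: (inner_commutator u1 uv aE a1 bl aM).
Qed.
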